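(* Let $\alpha\in(0,1)$, and suppose there are Banach spaces $(\mathcal V,\mathcal V')$ such that 1. $\langle u,v\rangle_{\mathcal X}\le\|u\|_{\mathcal V'}\|v\|_{\mathcal V}$ for all $v\in\mathcal V\cap\mathcal X$ and $u\in\mathcal V'\cap\mathcal X$; 2. the truth satisfies $u^\dagger\in\mathcal V\cap\mathcal X$ with $\|u^\dagger\|_{\mathcal V}\le1$; 3. $\operatorname{ran}T^*\subseteq\mathcal V'$ and $T^*:\mathcal Y\to\mathcal V'$ is bounded; 4. $\varphi\in\overline{\operatorname{ran}T^*}$, the closure being formed in $\mathcal V'$. Assume $\Phi_{\mathrm{MAP}}\neq0$. If the prior mean $m_0$ is chosen such that $$\langle m_0,T^*\Phi_{\mathrm{MAP}}-\varphi\rangle_{\mathcal X}=\sigma\|\Phi_{\mathrm{MAP}}\|_{\mathcal Y}Q^{-1}(1-\alpha)+\|T^*\Phi_{\mathrm{MAP}}-\varphi\|_{\mathcal V'},$$ then the MAP test $\Psi_{\mathrm{MAP}}$ has at most level $\alpha$, i.e. $\mathbb P_{u^\dagger}[\Psi_{\mathrm{MAP}}(Y)=1]\le\alpha$ for all $u^\dagger\in\mathcal X_H$ satisfying condition 2. With this choice of $m_0$, the power of $\Psi_{\mathrm{MAP}}$ for $u^\dagger\in\mathcal X_K$ (satisfying condition 2) is, moreover, given by $$\mathbb P_{u^\dagger}[\Psi_{\mathrm{MAP}}(Y)=1]=Q\left(Q^{-1}(\alpha)-\frac{J^{\mathcal Y}_{Tu^\dagger}(\Phi_{\mathrm{MAP}})}{\sigma}\right),$$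 where $$J^{\mathcal Y}_{Tu^\dagger}(\Phi):=\frac{\|T^*\Phi-\varphi\|_{\mathcal V'}-\langle\Phi,Tu^\dagger\rangle_{\mathcal Y}}{\|\Phi\|_{\mathcal Y}},\qquad \Phi\in\mathcal Y\setminus\{0\}.$$
   Context: $\mathcal X,\mathcal Y$ are real separable Hilbert spaces, $\varphi\in\mathcal X$, $T:\mathcal X\to\mathcal Y$ is bounded linear with adjoint $T^*$, $\sigma>0$, $m_0\in\mathcal X$, and $C_0$ is a self-adjoint, positive definite ($\langle x,C_0x\rangle>0$ for $x\ne0$), trace class operator on $\mathcal X$. $Q$ is the standard normal cumulative distribution function and $$\Phi_{\mathrm{MAP}}:=TC_0^{1/2}(C_0^{1/2}T^*TC_0^{1/2}+\sigma^2\mathrm{Id})^{-1}C_0^{1/2}\varphi.$$ $Z$ is Gaussian white noise on $\mathcal Y$: a family $(Z(g))_{g\in\mathcal Y}$ of centered, jointly Gaussian random variables, linear in $g$, with $\mathbb E[Z(g)Z(h)]=\langle g,h\rangle_{\mathcal Y}$. For $u\in\mathcal X$, $\mathbb P_u$ denotes the law of the data $Y=Tu+\sigma Z$, i.e. $Y(g)=\langle Tu,g\rangle_{\mathcal Y}+\sigma Z(g)$; realizations $y$ of $Y$ are linear functionals on $\mathcal Y$. For the Bayesian model with prior $\Pi=\mathcal N(m_0,C_0)$ (independent of $Z$), the posterior is the Gaussian measure $\Pi(\cdot|Y=y)=\mathcal N(m,C)$ on $\mathcal X$ with $C=\sigma^2C_0^{1/2}(C_0^{1/2}T^*TC_0^{1/2}+\sigma^2\mathrm{Id})^{-1}C_0^{1/2}$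 and $m=m_0+C_0^{1/2}(C_0^{1/2}T^*TC_0^{1/2}+\sigma^2\mathrm{Id})^{-1}C_0^{1/2}T^*(y-Tm_0)$, where $C_0^{1/2}T^*y\in\mathcal X$ is the Riesz representer of $x\mapsto y(TC_0^{1/2}x)$. The data are realized such that this functional is almost surely bounded on $\mathcal X$, so the posterior is defined almost surely. Put $\mathcal X_H=\{x:\langle\varphi,x\rangle\le0\}$, $\mathcal X_K=\{x:\langle\varphi,x\rangle>0\}$. The maximum a posteriori (MAP) test is $\Psi_{\mathrm{MAP}}(y)=1$ if $\Pi(\mathcal X_K|Y=y)>\Pi(\mathcal X_H|Y=y)$ and $\Psi_{\mathrm{MAP}}(y)=0$ otherwise. The spaces $\mathcal V,\mathcal V'$ and $\mathcal X$ are understood to lie in a common vector space so that intersections make sense. *)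

(* Defs.v *)
From HB Require Import structures.
From mathcomp Require Import all_boot all_order all_algebra.
From mathcomp Require Import all_classical all_reals all_analysis.

Set Implicit Arguments.
Unset Strict Implicit.
Unset Printing Implicit Defensive.

Import Order.TTheory GRing.Theory Num.Theory.
Import numFieldNormedType.Exports.

Local Open Scope classical_set_scope.
Local Open Scope ring_scope.

HB.mixin Record NormedModule_hasInner (R : realType) X
    of NormedModule R X := {
  inner : X -> X -> R ;
  innerC : forall x y, inner x y = inner y x ;
  inner_linearl : forall a x y z,
    inner (a *: x + y) z = a * inner x z + inner y z ;
  inner_normE : forall x, inner x x = `|x| ^+ 2
}.

#[short(type="hilbertType")]
HB.structure Definition Hilbert (R : realType) :=
  {X of NormedModule_hasInner R X & CompleteNormedModule R X}.

Definition separable_space (X : topologicalType) : Prop :=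
  exists2 D : set X, countable D & dense D.

(* For linear maps, being bounded near 0 is being bounded: linear_boundedP. *)
Definition bounded_map (R : realType) (X V : normedModType R) (f : X -> V)
    : Prop :=
  bounded_near f (nbhs (0 : X)).

Section operators.
Variable R : realType.
Implicit Types X Y : hilbertType R.

(* The value is meaningful when l is a bounded linear functional. *)
Definition riesz X (l : X -> R) : X :=
  xget 0 [set w | forall x, inner w x = l x].

Definition adjoint X Y (T : X -> Y) (y : Y) : X :=
  riesz (fun x => inner (T x) y).

Definition self_adjoint X (A : X -> X) : Prop :=
  forall x y, inner (A x) y = inner x (A y).

Definition positive_definite X (A : X -> X) : Prop :=
  forall x, x != 0 -> 0 < inner x (A x).

(* S is the (unique) nonnegative self-adjoint square root of A. *)
Definition is_sqrt X (A : X -> X) (S : {linear X -> X}) : Prop :=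
  [/\ bounded_map S, self_adjoint S, (forall x, 0 <= inner x (S x))
    & forall x, S (S x) = A x].

Definition orthonormal_basis X (E : set X) : Prop :=
  (forall e f, E e -> E f -> inner e f = (e == f)%:R) /\
  (forall x, (forall e, E e -> inner e x = 0) -> x = 0).

(* The trace norm, i.e. the trace of |A| = (A^* A)^(1/2), is finite. *)
Definition trace_class X (A : X -> X) : Prop :=
  bounded_map A /\
  exists absA : {linear X -> X}, is_sqrt (adjoint A \o A) absA /\
  exists E : set X, orthonormal_basis E /\
    (\esum_(e in E) (inner e (absA e))%:E < +oo)%E.

Definition op_inv X (A : X -> X) : X -> X := 'pinv_(fun=> 0) setT A.

End operators.

Section gaussian.
Variable R : realType.

(* N(m, s^2) on the line, including the degenerate case s = 0, for which
   normal_prob is not a Dirac measure. *)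
Definition gaussian (m s : R) (A : set R) : \bar R :=
  if s == 0 then \d_m A else normal_prob m s A.

Definition Q (x : R) : R := fine (normal_prob (0 : R) 1 `]-oo, x]).

Definition Qinv : R -> R := 'pinv_(fun=> 0) setT Q.

Definition borel (X : hilbertType R) := g_sigma_algebraType (@open X).

(* N(m, C): every marginal along h is N(<h, m>, <h, C h>). *)
Definition gaussian_measure (X : hilbertType R)
    (mu : probability (borel X) R) (m : X) (C : X -> X) : Prop :=
  forall (h : X) (A : set R), measurable A ->
    mu [set x : X | A (inner h x)] =
    gaussian (inner h m) (Num.sqrt (inner h (C h))) A.

(* The P-measure of E under the completion of P. *)
Definition has_prob (d : measure_display) (Om : measurableType d)
    (P : probability Om R) (E : set Om) (p : \bar R) : Prop :=
  exists A : set Om, [/\ measurable A, P.-negligible (A `+` E) & P A = p].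

Definition jointly_gaussian (I : Type) (d : measure_display)
    (Om : measurableType d) (P : probability Om R) (Z : I -> {RV P >-> R})
    : Prop :=
  forall (n : nat) (g : 'I_n -> I) (a : 'I_n -> R),
  exists m s : R, 0 <= s /\
    forall A : set R, measurable A ->
      P [set w | A (\sum_(i < n) a i * Z (g i) w)] = gaussian m s A.

Definition white_noise (Y : hilbertType R) (d : measure_display)
    (Om : measurableType d) (P : probability Om R) (Z : Y -> {RV P >-> R})
    : Prop :=
  [/\ forall w, scalar (fun g => Z g w),
      jointly_gaussian Z,
      forall g, ('E_P[Z g] = 0)%E
    & forall g h, ('E_P[fun w => (Z g w * Z h w)%R] = (inner g h)%:E)%E].

End gaussian.

Section model.
Variables (R : realType) (X Y : hilbertType R).

(* The realization w of the data T u + sigma Z, as a functional on Y. *)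
Definition data (T : X -> Y) (sigma : R) (d : measure_display)
    (Om : measurableType d) (P : probability Om R) (Z : Y -> {RV P >-> R})
    (u : X) (w : Om) : Y -> R :=
  fun g => inner (T u) g + sigma * Z g w.

(* In what follows S stands for C_0^(1/2). *)

(* (S T^* T S + sigma^2 Id)^(-1) *)
Definition resolvent (T : X -> Y) (sigma : R) (S : X -> X) : X -> X :=
  op_inv (fun x => S (adjoint T (T (S x))) + sigma ^+ 2 *: x).

Definition Phi_MAP (T : X -> Y) (sigma : R) (S : X -> X) (phi : X) : Y :=
  T (S (resolvent T sigma S (S phi))).

(* S T^* y, for a functional y on Y that need not be bounded. *)
Definition pullback (T : X -> Y) (S : X -> X) (y : Y -> R) : X :=
  riesz (fun x => y (T (S x))).

Definition posterior_mean (T : X -> Y) (sigma : R) (S : X -> X) (m0 : X)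
    (y : Y -> R) : X :=
  m0 + S (resolvent T sigma S
            (pullback T S (fun g => y g - inner (T m0) g))).

Definition posterior_cov (T : X -> Y) (sigma : R) (S : X -> X) (x : X) : X :=
  sigma ^+ 2 *: S (resolvent T sigma S (S x)).

(* post y is the posterior given Y = y; it is constrained only for those y
   for which the posterior is defined. *)
Definition is_posterior (T : X -> Y) (sigma : R) (S : X -> X) (m0 : X)
    (post : (Y -> R) -> probability (borel X) R) : Prop :=
  forall y : Y -> R, scalar y ->
    bounded_map (fun x : X => y (T (S x)) : R^o) ->
    gaussian_measure (post y) (posterior_mean T sigma S m0 y)
      (posterior_cov T sigma S).

Definition X_H (phi : X) : set X := [set x | inner phi x <= 0].
Definition X_K (phi : X) : set X := [set x | 0 < inner phi x].

Definition Psi_MAP (post : (Y -> R) -> probability (borel X) R) (phi : X)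
    (y : Y -> R) : nat :=
  if (post y (X_H phi) < post y (X_K phi))%E then 1 else 0.

(* TsV is T^* regarded as a map into V', and phiV is phi as an element of V'. *)
Definition J (V' : normedModType R) (TsV : Y -> V') (phiV : V') (v Phi : Y)
    : R :=
  (`|TsV Phi - phiV| - inner Phi v) / `|Phi|.

End model.

(* Main.v *)
Require Import Defs.
From HB Require Import structures.
From mathcomp Require Import all_boot all_order all_algebra.
From mathcomp Require Import all_classical all_reals all_analysis.
From mathcomp Require Import measurable_realfun.
From mathcomp Require Import ring lra.
Import Order.TTheory GRing.Theory Num.Theory.
Import numFieldNormedType.Exports.
Local Open Scope classical_set_scope.
Local Open Scope ring_scope.

Set Implicit Arguments.
Unset Strict Implicit.
Unset Printing Implicit Defensive.

(** The posterior law of <phi, x> given y is Gaussian with positive variance, so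
    the MAP test rejects iff its mean <phi, m> is positive. Since the resolvent
    is self-adjoint, <phi, m> = y(Phi_MAP) - <m0, T^* Phi_MAP - phi>: the MAP
    test is the threshold test based on y(Phi_MAP). For data y = T u + sigma Z
    the statistic y(Phi_MAP) is N(<T u, Phi_MAP>, sigma^2 |Phi_MAP|^2), which
    gives the rejection probability for every u; under the hypothesis, duality
    between V and V' makes J nonnegative, whence the level bound. *)

(** * Inner product algebra and the Cauchy-Schwarz inequality *)

Section inner_product.
Variables (R : realType) (X : hilbertType R).
Implicit Types x y z : X.

Lemma innerDl x y z : inner (x + y) z = inner x z + inner y z.
Proof. by rewrite -[x in LHS]scale1r inner_linearl mul1r. Qed.

Lemma inner0l z : inner 0 z = 0.
Proof. by apply: (addrI (inner 0 z)); rewrite -innerDl !addr0. Qed.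

Lemma innerZl a x z : inner (a *: x) z = a * inner x z.
Proof. by rewrite -[a *: x]addr0 inner_linearl inner0l addr0. Qed.

Lemma innerNl x z : inner (- x) z = - inner x z.
Proof. by rewrite -scaleN1r innerZl mulN1r. Qed.

Lemma innerDr x y z : inner z (x + y) = inner z x + inner z y.
Proof. by rewrite innerC innerDl !(innerC _ z). Qed.

Lemma innerZr a x z : inner z (a *: x) = a * inner z x.
Proof. by rewrite innerC innerZl (innerC _ z). Qed.

Lemma innerNr x z : inner z (- x) = - inner z x.
Proof. by rewrite innerC innerNl (innerC _ z). Qed.

Lemma inner_ge0 x : 0 <= inner x x.
Proof. by rewrite inner_normE sqr_ge0. Qed.

Lemma cauchy_schwarz x y : `|inner x y| <= `|x| * `|y|.
Proof.
have [->|y0] := eqVneq y 0; first by rewrite innerC inner0l !normr0 mulr0.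
have ny : 0 < `|y| by rewrite normr_gt0.
rewrite -ler_sqr ?nnegrE ?mulr_ge0// real_normK ?num_real//.
rewrite exprMn -!inner_normE.
have yy : 0 < inner y y by rewrite inner_normE exprn_gt0.
(* [t *: y] is the orthogonal projection of [x] on the line of [y]; the inequality is the
   nonnegativity of the squared norm of [x - t *: y], multiplied by [inner y y]. *)
set t := inner x y / inner y y.
have tE : t * inner y y = inner x y by rewrite /t divfK// gt_eqF.
have := inner_ge0 (x - t *: y).
rewrite innerDl !innerDr !(innerNl, innerNr, innerZl, innerZr) (innerC y x) -tE.
move: (inner x x) (inner y y) yy t {tE} => a b b0 t h.
rewrite -subr_ge0 (_ : _ - _ = b * (a - t ^+ 2 * b)); last ring.
by apply: mulr_ge0; [exact: ltW|lra].
Qed.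

End inner_product.

(** * The symmetric Lax-Milgram theorem by energy minimization *)

Section lax_milgram.
Variables (R : realType) (X : hilbertType R) (B : X -> X -> R) (l : X -> R).
Variables c M K : R.
Hypothesis BC : forall x y, B x y = B y x.
Hypothesis Bl : forall a x y z, B (a *: x + y) z = a * B x z + B y z.
Hypothesis c_gt0 : 0 < c.
Hypothesis B_coercive : forall x, c * `|x| ^+ 2 <= B x x.
Hypothesis M_gt0 : 0 < M.
Hypothesis B_bounded : forall x y, `|B x y| <= M * `|x| * `|y|.
Hypothesis ll : forall a x y, l (a *: x + y) = a * l x + l y.
Hypothesis l_bounded : forall x, `|l x| <= K * `|x|.

Let J x := B x x - 2 * l x.

Let J_expand x y t :
  J (t *: y + x) = J x + 2 * t * (B x y - l y) + t ^+ 2 * B y y.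
Proof.
rewrite /J Bl BC Bl (BC x (_ + _)) Bl ll (BC y x); ring.
Qed.

Let J_lb : has_lbound (range J).
Proof.
exists (- (K ^+ 2 / c)) => _ [x _ <-]; rewrite /J.
have := B_coercive x; have := l_bounded x; rewrite ler_norml => /andP[_].
set t := `|x| => lt Bt.
apply: (@le_trans _ _ (c * t ^+ 2 - 2 * (K * t))); last lra.
(* Completing the square shows that [c * t ^+ 2 - 2 * (K * t)] is at least [- (K ^+ 2 / c)]. *)
have : 0 <= (c * t - K) ^+ 2 / c by rewrite divr_ge0 ?sqr_ge0// ltW.
have -> : (c * t - K) ^+ 2 / c = c * t ^+ 2 - 2 * (K * t) + K ^+ 2 / c.
  by field; rewrite gt_eqF.
lra.
Qed.

Let m := inf (range J).

Let m_le x : m <= J x.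
Proof. by apply: ge_inf => //; exists x. Qed.

(** By the parallelogram identity, [J] at the midpoint of [x] and [y] is the average of [J x] and
    [J y] minus a quarter of [B (x - y) (x - y)]; it is still at least [m], and coercivity
    concludes. *)
Let J_midpoint x y : c * `|x - y| ^+ 2 <= 2 * (J x - m) + 2 * (J y - m).
Proof.
have := B_coercive (x - y).
have := m_le (2^-1 *: (x - y) + y); rewrite J_expand.
have : J x = J (1 *: (x - y) + y) by rewrite scale1r subrK.
rewrite J_expand expr1n exprVn; lra.
Qed.

(** Moving from [x] along [y] cannot bring [J] below [m]; the best step, [- (B x y - l y) / B y y],
    lowers [J] by the squared residual over [B y y]. *)
Let J_residual x y : (B x y - l y) ^+ 2 <= (J x - m) * B y y.
Proof.
have [->|y0] := eqVneq y 0.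
  have l0 : l 0 = 0 by have := ll (-1) 0 0; rewrite scaler0 addr0 mulN1r addNr.
  have B0 z : B z 0 = 0.
    by have := Bl (-1) 0 0 z; rewrite scaler0 addr0 mulN1r addNr BC.
  by rewrite l0 !B0 subr0 expr0n mulr0.
have Byy : 0 < B y y.
  by apply: lt_le_trans (B_coercive y); rewrite mulr_gt0// exprn_gt0// normr_gt0.
have := m_le (- (B x y - l y) / B y y *: y + x); rewrite J_expand.
set r := B x y - l y; set b := B y y => h.
rewrite -ler_pdivrMr//.
have -> : r ^+ 2 / b = - (2 * (- r / b) * r + (- r / b) ^+ 2 * b).
  by field; rewrite gt_eqF.
lra.
Qed.

(* [l] is represented by the minimizer of [B x x - 2 * l x]: the midpoint
   inequality makes a minimizing sequence Cauchy, and the residual bound passes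
   to the limit. *)
Lemma symmetric_lax_milgram : exists w, forall x, B w x = l x.
Proof.
have : forall n : nat, exists x, J x < m + n.+1%:R^-1.
  move=> n; have [||_ [x _ <-] xm] := @inf_adherent R (range J) n.+1%:R^-1.
  - by rewrite invr_gt0 ltr0n.
  - by split => //; exists (J 0); exists 0.
  - by exists x.
move=> /choice[u Ju].
have Jsmall (e : R) : 0 < e -> \forall n \near \oo, J (u n) - m <= e.
  move=> e0; near=> n.
  suff le_e : n.+1%:R^-1 <= e.
    by rewrite lerBlDl (le_trans (ltW (Ju n)))// lerD2l.
  by apply: ltW; near: n; exact: (near_infty_natSinv_lt (PosNum e0)).
have u_cvg : cvg (u @ \oo).
  apply: cauchy_cvg; apply/cauchy_exP => e e0.
  (* With both gaps [J - m] at most this value, the midpoint inequality gives [c * (e / 2) ^+ 2] on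
     the right, hence a distance at most [e / 2]. *)
  have d0 : 0 < c * (e / 2) ^+ 2 / 4.
    by rewrite divr_gt0// mulr_gt0// exprn_gt0// divr_gt0.
  have [N _ JN] := Jsmall _ d0.
  exists (u N); exists N => // n /= Nn.
  rewrite -ball_normE /=.
  have := J_midpoint (u N) (u n).
  have := JN _ Nn; have := JN _ (leqnn N) => /= h1 h2 h3.
  have h4 : c * `|u N - u n| ^+ 2 <= c * (e / 2) ^+ 2. by lra.
  move: h4; rewrite ler_pM2l// ler_pXn2r ?nnegrE//; last lra.
  lra.
exists (lim (u @ \oo)) => x; set w := lim _.
apply/eqP; rewrite -subr_eq0 -normr_le0.
(* The first summand pays for replacing the limit by [u n], the second for the residual at [u n];
   [1 + B x x] dominates the square root of [B x x], so that no root has to be taken. *)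
set C := M * `|x| + (1 + B x x).
have Bx0 y : 0 <= B y y.
  by apply: le_trans (B_coercive y); rewrite mulr_ge0 ?sqr_ge0// ltW.
have C0 : 0 < C.
  apply: ltr_wpDl; first by rewrite mulr_ge0// ltW.
  by rewrite ltr_pwDl.
apply/ler_addgt0Pr => e e0; rewrite add0r.
have d0 : 0 < e / C by rewrite divr_gt0.
near \oo => n.
have wn : `|w - u n| <= e / C.
  by near: n; move/cvgrPdist_le : u_cvg; exact.
have Jn : J (u n) - m <= (e / C) ^+ 2.
  by near: n; apply: Jsmall; rewrite exprn_gt0.
have -> : B w x - l x = B (w - u n) x + (B (u n) x - l x).
  by have := Bl 1 (w - u n) (u n) x; rewrite scale1r subrK mul1r => ->; ring.
have -> : e = e / C * C by rewrite divfK// gt_eqF.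
rewrite {2}/C mulrDr (le_trans (ler_normD _ _))// lerD//.
  apply: le_trans (B_bounded _ _) _.
  by rewrite mulrCA -mulrA ler_pM2l// ler_wpM2r.
have eC0 : 0 <= e / C * (1 + B x x) by rewrite mulr_ge0 ?addr_ge0// ltW.
rewrite -ler_sqr ?nnegrE// real_normK ?num_real//.
apply: le_trans (J_residual _ _) _.
apply: (@le_trans _ _ ((e / C) ^+ 2 * B x x)); first by rewrite ler_wpM2r.
rewrite [leRHS]exprMn; apply: ler_wpM2l; first exact: sqr_ge0.
have := Bx0 x; nra.
Unshelve. all: by end_near. Qed.

End lax_milgram.

(** * Bounded linear maps, Riesz representation and adjoints *)

Section riesz_adjoint.
Variable R : realType.
Implicit Types X Y : hilbertType R.

Lemma bounded_mapP (X V : normedModType R) (f : X -> V) :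
  linear f -> bounded_map f ->
  exists2 M, 0 < M & forall x, `|f x| <= M * `|x|.
Proof.
move=> lf; pose m := GRing.isLinear.Build _ _ _ _ f lf.
pose g : {linear X -> V} := HB.pack f m.
move=> /(@linear_boundedP R X V g)/pinfty_ex_gt0[M M0 fM].
by exists M.
Qed.

Lemma bound_bounded_map (X V : normedModType R) (f : X -> V) (M : R) :
  (forall x, `|f x| <= M * `|x|) -> bounded_map f.
Proof.
move=> fM; apply/ex_bound; exists `|M|.
apply/nbhs_norm0P; exists 1 => //= x x1.
apply: le_trans (fM x) _; apply: (@le_trans _ _ (`|M| * `|x|)).
  by rewrite ler_wpM2r// ler_norm.
by rewrite ler_piMr// ltW.
Qed.

(** Lax-Milgram for the inner product itself, with both constants equal to 1, yields a representer,
    so the default value in [riesz] is not taken. *)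
Lemma rieszE X (l : X -> R) : scalar l ->
  bounded_map (l : X -> R^o) -> forall x, inner (riesz l) x = l x.
Proof.
move=> sl /(@bounded_mapP X R^o _ sl)[K K0 lK].
rewrite /riesz; case: xgetP => [w -> //|noriesz].
have [||w wl] := @symmetric_lax_milgram R X (@inner R X) l 1 1 K
  (@innerC R X) (@inner_linearl R X) ltr01 _ ltr01 _ sl lK.
- by move=> x; rewrite mul1r inner_normE.
- by move=> x y; rewrite mul1r cauchy_schwarz.
- by case: (noriesz w).
Qed.

Lemma adjointE X Y (T : {linear X -> Y}) y x : bounded_map T ->
  inner (adjoint T y) x = inner (T x) y.
Proof.
move=> /(bounded_mapP (linearP T))[M M0 TM].
rewrite rieszE//; first by move=> a u v; rewrite linearP inner_linearl.
apply: (@bound_bounded_map X R^o _ (M * `|y|)) => u.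
apply: le_trans (cauchy_schwarz _ _) _.
by rewrite mulrAC ler_wpM2r.
Qed.

(** * The regularized resolvent: existence, symmetry and positivity *)

Section resolvent.
Variables (X Y : hilbertType R) (T : {linear X -> Y}) (sigma : R).
Variable S : {linear X -> X}.
Hypotheses (bT : bounded_map T) (bS : bounded_map S) (S_sa : self_adjoint S).
Hypothesis sigma_gt0 : 0 < sigma.

Let A x := S (adjoint T (T (S x))) + sigma ^+ 2 *: x.

Let inner_A x y : inner (A x) y = inner (T (S x)) (T (S y)) + sigma ^+ 2 * inner x y.
Proof. by rewrite innerDl innerZl S_sa adjointE// (innerC (T (S y))). Qed.

(** [op_inv] is a right inverse on the range of [A], so it suffices that [A] is onto. Lax-Milgram
    solves [A w = f] weakly: the form [B] of [A] has coercivity constant [sigma ^+ 2], contributed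
    by the regularizing term. *)
Lemma resolventK f : A (resolvent T sigma S f) = f.
Proof.
rewrite /resolvent /op_inv; apply: pinvK; rewrite inE /=.
have [M M0 TM] := bounded_mapP (linearP T) bT.
have [N N0 SN] := bounded_mapP (linearP S) bS.
have TS x : `|T (S x)| <= M * N * `|x|.
  by apply: le_trans (TM _) _; rewrite -mulrA ler_pM2l.
have s2 : 0 < sigma ^+ 2 by rewrite exprn_gt0.
pose B x y := inner (T (S x)) (T (S y)) + sigma ^+ 2 * inner x y.
have BC x y : B x y = B y x.
  by rewrite /B innerC (innerC x).
have Bl a x y z : B (a *: x + y) z = a * B x z + B y z.
  by rewrite /B !linearP !inner_linearl; ring.
have Bc x : sigma ^+ 2 * `|x| ^+ 2 <= B x x.
  by rewrite /B -inner_normE lerDr inner_ge0.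
have Bb x y : `|B x y| <= ((M * N) ^+ 2 + sigma ^+ 2) * `|x| * `|y|.
  rewrite (le_trans (ler_normD _ _))// !mulrDl lerD//.
    apply: le_trans (cauchy_schwarz _ _) _.
    rewrite (_ : _ * `|x| * `|y| = (M * N * `|x|) * (M * N * `|y|)); last ring.
    by rewrite ler_pM.
  by rewrite normrM gtr0_norm// -mulrA ler_pM2l// cauchy_schwarz.
have M20 : 0 < (M * N) ^+ 2 + sigma ^+ 2 by rewrite addr_gt0// exprn_gt0// mulr_gt0.
have lf a x y : inner f (a *: x + y) = a * inner f x + inner f y.
  by rewrite innerDr innerZr.
have [w wf] := symmetric_lax_milgram BC Bl s2 Bc M20 Bb lf (cauchy_schwarz f).
(* The weak equation is tested against the residual [A w - f] itself, whose norm therefore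
   vanishes. *)
exists w => //; apply/eqP; rewrite -subr_eq0 -normr_eq0 -sqrf_eq0 -inner_normE.
by rewrite innerDl innerNl -wf inner_A subrr.
Qed.

(** Writing [f] and [g] as images under [A] of their resolvents reduces the claim to the symmetry of
    the form of [A]. *)
Lemma inner_resolvent f g :
  inner f (resolvent T sigma S g) = inner (resolvent T sigma S f) g.
Proof.
rewrite -[f in LHS]resolventK inner_A -[g in RHS]resolventK.
by rewrite [RHS]innerC inner_A innerC (innerC (resolvent T sigma S g)).
Qed.

(** With [r] the resolvent of [f], the left factor is [A r], so the product is at least [sigma ^+ 2]
    times the squared norm of [r]; and [r = 0] would force [f = A 0 = 0]. *)
Lemma inner_resolvent_gt0 f : f != 0 -> 0 < inner f (resolvent T sigma S f).
Proof.
move=> f0; rewrite -{1}[f]resolventK inner_A ltr_wpDl ?inner_ge0//.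
rewrite mulr_gt0 ?exprn_gt0// inner_normE exprn_gt0// normr_gt0.
apply: contra_neq f0 => r0.
rewrite -[f]resolventK r0 -[LHS]/(A 0).
apply/eqP; rewrite -normr_eq0 -sqrf_eq0 -inner_normE inner_A !linear0.
by rewrite !inner0l mulr0 addr0.
Qed.

End resolvent.
End riesz_adjoint.

(** * The standard normal distribution function and its inverse *)

Section standard_normal_cdf.
Variable R : realType.
Local Notation mu := (@lebesgue_measure R).

Lemma Q_E (x : R) : (Q x)%:E = normal_prob 0 1 `]-oo, x].
Proof. by rewrite /Q fineK// fin_num_measure. Qed.

(** Standardization: the substitution [F x = (x - m) / s] carries one density to the other, its
    derivative [s^-1] matching the ratio of the normalizing constants. *)
Lemma normal_prob_ray (m s b : R) : 0 < s ->
  normal_prob m s `]-oo, b] = (Q ((b - m) / s))%:E.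
Proof.
move=> s0; have sn0 : s != 0 by rewrite gt_eqF.
pose F (x : R) := (x - m) / s.
have dF (x : R) : is_derive x 1 F s^-1.
  rewrite /F; have := is_deriveM (is_deriveB (is_derive_id x 1) (is_derive_cst m x 1)) (is_derive_cst s^-1 x 1).
  by rewrite scaler0 add0r subr0 => h; apply: is_derive_eq h _; rewrite /GRing.scale/= mulr1.
have F'E : F^`()%classic = cst s^-1.
  by apply/funext => x; rewrite derive1E (@derive_val _ _ _ _ _ _ _ (dF x)).
rewrite Q_E /normal_prob -/(F b).
rewrite (@increasing_ge0_integration_by_substitutionNy _ F (normal_pdf 0 1) b).
- apply: eq_integral => x _; congr EFin.
  rewrite F'E !normal_pdfE ?oner_neq0//.
  change (normal_peak s * normal_fun m s x =
    normal_peak 1 * normal_fun 0 1 (F x) * s^-1).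
  have -> : normal_peak s = normal_peak 1 * s^-1.
    rewrite /normal_peak -invfM; congr (_^-1).
    by rewrite expr1n mul1r -mulrnAr sqrtrM ?sqr_ge0// sqrtr_sqr gtr0_norm// mulrC.
  rewrite mulrAC; congr (_ * expR _ * _).
  by rewrite /F subr0; field.
- by move=> x y _ _ xy; rewrite /F ltr_pM2r ?invr_gt0// ltrD2r.
- by move=> x _; rewrite F'E; exact: cvg_cst.
- by rewrite F'E; exact: is_cvg_cst.
- by rewrite F'E; exact: cvg_cst.
- split; first by move=> x _; exact: (@ex_derive _ _ _ _ _ _ _ (dF x)).
  apply: cvg_at_left_filter; apply: differentiable_continuous.
  by apply/derivable1_diffP; exact: (@ex_derive _ _ _ _ _ _ _ (dF b)).
- apply/gt0_cvgMlNy; last exact: cvg_addrr_Ny.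
  by rewrite invr_gt0.
- by apply: continuous_subspaceT; apply: continuous_normal_pdf; rewrite oner_neq0.
- by move=> x _; exact: normal_pdf_ge0.
Qed.

Lemma normal_prob_compl_ray (m s b : R) : 0 < s ->
  normal_prob m s `]b, +oo[ = (1 - Q ((b - m) / s))%:E.
Proof.
move=> s0.
have -> : `]b, +oo[%classic = ~` `]-oo, b]%classic.
  by rewrite setCitvl.
by rewrite EFinB -normal_prob_ray// -probability_setC.
Qed.

(** The density is even, so the lower ray up to [- x] is reflected onto the upper ray from [x],
    whose endpoint is a null set. *)
Lemma QN (x : R) : Q (- x) = 1 - Q x.
Proof.
apply: EFin_inj; have := @normal_prob_compl_ray 0 1 x ltr01.
rewrite subr0 divr1 => <-; rewrite Q_E /normal_prob.
have cpdf : continuous (@normal_pdf R 0 1).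
  by apply: continuous_normal_pdf; rewrite oner_neq0.
rewrite ge0_integration_by_substitutionNy//; last 2 first.
- exact: continuous_subspaceT.
- by move=> y _; exact: normal_pdf_ge0.
rewrite -integral_itv_obnd_cbnd; last first.
  apply/measurable_EFinP/measurableT_comp; last exact: oppr_measurable.
  exact: measurable_normal_pdf.
apply: eq_integral => y _; congr EFin => /=.
by rewrite !normal_pdfE ?oner_neq0// /normal_fun !subr0 sqrrN.
Qed.

Lemma Q_itv (a b : R) : a <= b -> (Q b - Q a)%:E = normal_prob 0 1 `]a, b].
Proof.
move=> ab; rewrite EFinB !Q_E.
have -> : `]-oo, b]%classic = `]-oo, a] `|` `]a, b] :> set R.
  by rewrite -itv_bndbnd_setU.
rewrite measureU//; last first.
  by apply/seteqP; split => // x [] /=; rewrite !in_itv/=; case: ltgtP => // ? ?; case: ltgtP.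
by rewrite addeAC subee ?add0e// fin_num_measure.
Qed.

Lemma Q_lt (a b : R) : a < b -> Q a < Q b.
Proof.
move=> ab; rewrite -subr_gt0 -lte_fin Q_itv ?ltW//.
(* A lower bound of the density on the interval, where [|x|] is at most [|a| + |b|]. *)
pose c : R := normal_peak 1 * expR (- (`|a| + `|b|) ^+ 2 / 2).
have c0 : 0 < c by rewrite mulr_gt0 ?expR_gt0// normal_peak_gt0// oner_neq0.
apply: (@lt_le_trans _ _ (\int[mu]_(x in `]a, b]) c%:E)%E).
  rewrite integral_cst//= lebesgue_measure_itv/= lte_fin ab -EFinD -EFinM lte_fin.
  by rewrite mulr_gt0// subr_gt0.
apply: ge0_le_integral => //.
- by move=> x _; rewrite lee_fin ltW.
- by apply/measurable_EFinP/measurable_funTS; exact: measurable_normal_pdf.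
move=> x; rewrite /= in_itv/= => /andP[ax xb].
rewrite lee_fin normal_pdfE ?oner_neq0// /c /normal_fun ler_pM2l ?normal_peak_gt0 ?oner_neq0//.
rewrite ler_expR subr0 expr1n ler_pM2r ?invr_gt0// lerN2.
rewrite -[x ^+ 2]real_normK ?num_real// ler_sqr ?nnegrE ?addr_ge0//.
rewrite ler_norml; apply/andP; split.
  have := ler_norm (- a); have := normr_ge0 b; rewrite normrN; lra.
have := ler_norm b; have := normr_ge0 a; lra.
Qed.

Lemma Q_le (a b : R) : a <= b -> Q a <= Q b.
Proof. by rewrite le_eqVlt => /predU1P[->//|/Q_lt/ltW]. Qed.

Lemma Q_inj : injective (@Q R).
Proof.
move=> a b Qab; have [/Q_lt|/Q_lt|//] := ltgtP a b; by rewrite Qab ltxx.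
Qed.

(** The density never exceeds its peak; this Lipschitz bound gives the continuity of [Q]. *)
Lemma Q_lip (a b : R) : a <= b -> Q b - Q a <= normal_peak 1 * (b - a).
Proof.
move=> ab; rewrite -lee_fin Q_itv//.
have -> : (normal_peak 1 * (b - a))%:E =
    (\int[mu]_(x in `]a, b]) (normal_peak (1 : R))%:E)%E.
  rewrite integral_cst//= lebesgue_measure_itv/= lte_fin.
  move: ab; rewrite le_eqVlt => /predU1P[->|ab]; last by rewrite ab -EFinD -EFinM.
  by rewrite ltxx subrr mulr0 mule0.
apply: ge0_le_integral => //.
- by move=> x _; rewrite lee_fin normal_pdf_ge0.
- by apply/measurable_EFinP/measurable_funTS; exact: measurable_normal_pdf.
by move=> x _; rewrite lee_fin normal_pdf_ub// oner_neq0.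
Qed.

Lemma continuous_Q : continuous (@Q R).
Proof.
move=> x; apply/cvgrPdist_le => e e0.
have k0 : 0 < normal_peak (1 : R) by rewrite normal_peak_gt0// oner_neq0.
near=> y.
have : `|x - y| <= e / normal_peak 1.
  by near: y; apply: cvgr_dist_le; rewrite ?divr_gt0//; exact: cvg_id.
rewrite ler_pdivlMr// mulrC; apply: le_trans.
have [xy|/ltW yx] := leP x y.
  rewrite distrC ger0_norm ?subr_ge0 ?Q_le//.
  by rewrite distrC ger0_norm ?subr_ge0// Q_lip.
by rewrite ger0_norm ?subr_ge0 ?Q_le// ger0_norm ?subr_ge0// Q_lip.
Unshelve. all: by end_near. Qed.

(** The identity seen as a random variable: under [stdN] its distribution function is [Q], which
    gives access to the limits of [cdf] at both infinities. *)
Let idTR : measurableTypeR R -> R := idfun.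

#[local] HB.instance Definition _ :=
  @isMeasurableFun.Build _ _ _ _ idTR (@measurable_id _ _ setT).

Let stdN : probability (measurableTypeR R) R := normal_prob 0 1.

(** It suffices that [a] is a value of [Q]: the limits 0 and 1 provide points where [Q] is below and
    above [a], and the intermediate value theorem applies between them. *)
Lemma QinvK (a : R) : 0 < a < 1 -> Q (Qinv a) = a.
Proof.
move=> /andP[a0 a1]; apply: pinvK; rewrite inE /=.
have cdfE (x : R) : cdf (idTR : {RV stdN >-> R}) x = (Q x)%:E.
  by rewrite /cdf /distribution /pushforward Q_E.
have [u Qu] : exists u : R, Q u < a.
  have := @cvg_cdfNy0 _ _ _ _ (idTR : {RV stdN >-> R}).
  move=> /(_ [set y | y < a%:E]%E) [|M [_ hM]].
    by apply: open_nbhs_nbhs; split; [exact: open_ereal_lt_ereal|rewrite /= lte_fin].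
  by exists (M - 1); rewrite -lte_fin -cdfE; apply: hM; lra.
have [v Qv] : exists v : R, a < Q v.
  have := @cvg_cdfy1 _ _ _ _ (idTR : {RV stdN >-> R}).
  move=> /(_ [set y | a%:E < y]%E) [|M [_ hM]].
    by apply: open_nbhs_nbhs; split; [exact: open_ereal_gt_ereal|rewrite /= lte_fin].
  by exists (M + 1); rewrite -lte_fin -cdfE; apply: hM; lra.
have uv : u <= v.
  by rewrite leNgt; apply/negP => /Q_lt; lra.
have [||c _ Qc] := @IVT R (@Q R) u v a uv; last by exists c.
  exact/continuous_subspaceT/continuous_Q.
by rewrite min_l ?max_r ?Q_le// (ltW Qu) ltW.
Qed.

Lemma Qinv_onem (a : R) : 0 < a < 1 -> Qinv (1 - a) = - Qinv a.
Proof.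
move=> a01; apply: Q_inj; rewrite QN !QinvK//.
by move/andP: a01 => [? ?]; apply/andP; split; lra.
Qed.

(** The two half-lines have probabilities [Q (- (m / s))] and [Q (m / s)], and [Q] is strictly
    increasing. This turns the comparison of posterior probabilities into the sign of a mean. *)
Lemma normal_prob_sign (m s : R) : 0 < s ->
  (normal_prob m s `]-oo, 0%R] < normal_prob m s `]0%R, +oo[)%E = (0 < m).
Proof.
move=> s0; rewrite normal_prob_ray// normal_prob_compl_ray// lte_fin -QN.
rewrite sub0r mulNr opprK.
have [m0|m0] := ltP 0 m.
  by apply: Q_lt; have : 0 < m / s by [rewrite divr_gt0]; lra.
apply/negbTE; rewrite -leNgt; apply: Q_le.
have : m / s <= 0 by rewrite mulr_le0_ge0// invr_ge0 ltW.
lra.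
Qed.

End standard_normal_cdf.

(** * Integrals of derivatives over the whole line *)

Section improper_integral.
Variable R : realType.
Local Notation mu := (@lebesgue_measure R).

(** The fundamental theorem of calculus applies on symmetric intervals around [m]. Dominated
    convergence passes to the whole line, and the decay of [F] kills the boundary terms. *)
Lemma integral_derivative_eq0 (f F : R -> R) (m C : R) :
  continuous f -> mu.-integrable setT (EFin \o f) ->
  (forall x : R, is_derive x 1 F (f x)) ->
  (forall x, `|F x| * `|x - m| <= C) ->
  (\int[mu]_x (f x)%:E = 0)%E.
Proof.
move=> cf intf dF FC.
pose D (n : nat) := `[m - n.+1%:R, m + n.+1%:R]%classic : set R.
pose f_ n := (EFin \o f) \_ (D n).
have mf : measurable_fun setT (EFin \o f) by case/integrableP : intf.
have f_f x : f_ n x @[n --> \oo] --> (f x)%:E.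
  apply: cvg_near_cst; near=> n; rewrite /f_ patchE ifT// inE /D /= in_itv/=.
  have : `|x - m| <= n.+1%:R.
    apply: (@le_trans _ _ n%:R); last by rewrite ler_nat.
    by near: n; exact: nbhs_infty_ger.
  by rewrite ler_norml => /andP[? ?]; apply/andP; split; lra.
have [||||| _ _ cvgI] := @dominated_convergence _ _ R mu setT measurableT f_
  (EFin \o f) (fun x => `|f x|%:E).
- move=> n; apply/(measurable_restrictT (EFin \o f)); first exact: measurable_itv.
  exact: measurable_funTS.
- exact: mf.
- by apply: aeW => x _; exact: f_f.
- exact: integrable_abse intf.
- apply: aeW => x n _; rewrite /f_ patchE; case: ifP => _ //=.
  by rewrite normr0 lee_fin.
have IE n : (\int[mu]_x f_ n x = (F (m + n.+1%:R) - F (m - n.+1%:R))%:E)%E.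
  rewrite -integral_mkcond EFinB; apply: continuous_FTC2.
  - by have : 0 < n.+1%:R :> R by []; lra.
  - exact: continuous_subspaceT.
  - have cF x : {for x, continuous F}.
      apply: differentiable_continuous; apply/derivable1_diffP.
      exact: (@ex_derive _ _ _ _ _ _ _ (dF x)).
    split=> [x _||].
    + exact: (@ex_derive _ _ _ _ _ _ _ (dF x)).
    + by apply: cvg_at_right_filter; exact: cF.
    + by apply: cvg_at_left_filter; exact: cF.
  - by move=> x _; rewrite derive1E (@derive_val _ _ _ _ _ _ _ (dF x)).
apply/esym; apply: cvg_unique cvgI => //=.
under eq_fun do rewrite IE.
apply/fine_cvgP; split; first by near=> n.
apply/cvgr0Pnorm_le => e e0; near=> n => /=.
have n0 : 0 < n.+1%:R :> R by rewrite ltr0n.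
have hp := FC (m + n.+1%:R); have hm := FC (m - n.+1%:R).
have C0 : 0 <= C by apply: le_trans hp; rewrite mulr_ge0.
(* Each of the two boundary terms is at most [C / n.+1%:R]. *)
have : 2 * C / n.+1%:R <= e.
  rewrite ler_pdivrMr// [leRHS]mulrC -ler_pdivrMr//.
  apply: (@le_trans _ _ n%:R); last by rewrite ler_nat.
  by near: n; exact: nbhs_infty_ger.
apply: le_trans; rewrite ler_pdivlMr//.
move: hp hm; have -> (k : R) : m + k - m = k by ring.
have -> (k : R) : m - k - m = - k by ring.
rewrite normrN (gtr0_norm n0) => hp hm.
apply: (@le_trans _ _ ((`|F (m + n.+1%:R)| + `|F (m - n.+1%:R)|) * n.+1%:R)).
  by rewrite ler_pM2r// ler_normB.
rewrite mulrDl; lra.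
Unshelve. all: by end_near. Qed.

End improper_integral.

(** * First two moments of a nondegenerate normal law *)

Section normal_moments.
Variables (R : realType) (m s : R).
Hypothesis s_gt0 : 0 < s.
Local Notation mu := (@lebesgue_measure R).
Local Notation N := (normal_prob m s).
Local Notation p := (normal_pdf m s).

Let s_neq0 : s != 0. Proof. by rewrite gt_eqF. Qed.

(** The Radon-Nikodym derivative of the law and the explicit density integrate alike over every
    measurable set, hence agree almost everywhere. *)
Lemma integral_normal_prob (f : R -> \bar R) :
  N.-integrable setT f ->
  (\int[N]_x f x = \int[mu]_x (f x * (p x)%:E))%E.
Proof.
move=> intf; have mf : measurable_fun [set: measurableTypeR R] f by case/integrableP : intf.
have mp : measurable_fun [set: measurableTypeR R] (fun x => (p x)%:E).
  by apply/measurable_EFinP; exact: measurable_normal_pdf.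
have dom := normal_prob_dominates m s.
rewrite -(Radon_Nikodym_change_of_variables dom measurableT intf).
have mRN : measurable_fun [set: measurableTypeR R]
    (Radon_Nikodym (charge_of_finite_measure N) mu).
  by apply: (measurable_int mu); apply: Radon_Nikodym_integrable; exact: dom.
apply: ae_eq_integral => //.
- exact: (emeasurable_funM mf mRN).
- exact: (emeasurable_funM mf mp).
- apply: ae_eqe_mul2l => /=; rewrite Radon_NikodymE//=.
  case: cid => /= h [h1 h2 h3]; apply: integral_ae_eq => //=.
  by move=> E _ mE; rewrite -h3.
Qed.

Lemma integrable_normal_density (f : R -> R) :
  N.-integrable setT (EFin \o f) ->
  mu.-integrable setT (EFin \o (fun x => f x * p x)).
Proof.
move=> intf; have mf : measurable_fun setT f.
  by case/integrableP : intf => /measurable_EFinP.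
apply/integrableP; split.
  apply/measurable_EFinP/measurable_funM => //; exact: measurable_normal_pdf.
have /integrableP[_] := intf.
rewrite (integral_normal_prob (integrable_abse intf)); apply: le_lt_trans.
rewrite le_eqVlt; apply/orP; left; apply/eqP; apply: eq_integral => x _ /=.
by rewrite normrM (ger0_norm (normal_pdf_ge0 _ _ _)).
Qed.

Let is_derive_pdf (x : R) : is_derive x 1 p ((m - x) / s ^+ 2 * p x).
Proof.
rewrite normal_pdfE//.
pose g (x : R) := - (x - m) ^+ 2 / (s ^+ 2 *+ 2).
have dg : is_derive x 1 g ((m - x) / s ^+ 2).
  rewrite /g; apply: is_derive_eq; rewrite /GRing.scale/=.
  by field.
have := is_derive1_comp (is_derive_expR (g x)) dg.
move=> /(is_deriveZ (normal_peak s)) h.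
apply: is_derive_eq h _; rewrite /GRing.scale/= /normal_fun -/(g x); ring.
Qed.

(** This is [1 + t <= expR t] at [t = (x - m) ^+ 2 / (s ^+ 2 *+ 2)]; it supplies the decay needed
    for the boundary terms. *)
Let pdf_decay (x : R) : p x * (1 + (x - m) ^+ 2 / (s ^+ 2 *+ 2)) <= normal_peak s.
Proof.
rewrite normal_pdfE// /normal_fun -mulrA ler_piMr ?normal_peak_ge0//.
rewrite mulNr expRN mulrC ler_pdivrMr ?expR_gt0// mul1r.
exact: expR_ge1Dx.
Qed.

Let pdf_decay_sqr (x : R) : p x * (x - m) ^+ 2 <= 2 * s ^+ 2 * normal_peak s.
Proof.
have s2 : 0 < 2 * s ^+ 2 by rewrite mulr_gt0// exprn_gt0.
have := pdf_decay x; rewrite -(ler_pM2l s2); apply: le_trans.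
rewrite (_ : 2 * s ^+ 2 * _ = 2 * s ^+ 2 * p x + p x * (x - m) ^+ 2); last by field.
by rewrite lerDr mulr_ge0 ?normal_pdf_ge0// ltW.
Qed.

Let pdf_decay_norm (x : R) :
  p x * `|x - m| <= normal_peak s + 2 * s ^+ 2 * normal_peak s.
Proof.
have := pdf_decay_sqr x; have := normal_pdf_ub m x s_neq0.
have := normal_pdf_ge0 m s x; rewrite -(real_normK (num_real (x - m))).
move: (p x) `|x - m| => q t q0 qk qK.
apply: (@le_trans _ _ (q * (1 + t ^+ 2))); last lra.
by apply: ler_wpM2l => //; nra.
Qed.

(* The moments follow by integrating the derivatives of [s ^+ 2 * p] and
   [(x - m) * (s ^+ 2 * p)]; finiteness of the second moment is what makes
   these derivatives integrable. *)
Lemma normal_prob_moments (v : R) :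
  (\int[N]_x (x ^+ 2)%:E = v%:E)%E ->
  (\int[N]_x x%:E = m%:E)%E /\ v = s ^+ 2 + m ^+ 2.
Proof.
move=> Ev.
have int2 : N.-integrable setT (EFin \o (fun x : R => x ^+ 2)).
  apply/integrableP; split; first exact/measurable_EFinP/measurable_funX.
  under eq_integral do rewrite /= ger0_norm ?sqr_ge0//.
  by rewrite Ev ltry.
have int0 (a : R) : N.-integrable setT (EFin \o cst a).
  exact: finite_measure_integrable_cst.
have int1 : N.-integrable setT (EFin \o (fun x : R => x)).
  have mid : measurable_fun [set: measurableTypeR R] (EFin \o (fun x : R => x)).
    exact/measurable_EFinP.
  apply: (le_integrable measurableT mid _ (integrableD measurableT (int0 1) int2)).
  move=> x _ /=; rewrite lee_fin ler_norml.
  rewrite ger0_norm ?addr_ge0 ?sqr_ge0//; apply/andP; split; nra.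
have [e Ee] : exists e : R, (\int[N]_x x%:E = e%:E)%E.
  exists (fine (\int[N]_x x%:E)); rewrite fineK//; exact: integrable_fin_num int1.
(* Both derivatives to be integrated are a quadratic [q] times [p]: [m - x] for [s ^+ 2 * p], and
   [s ^+ 2 - (x - m) ^+ 2] for [(x - m) * (s ^+ 2 * p)]. Their integrals are affine in the mean [e]
   and the second moment [v]. *)
pose q (a b c x : R) := a + (b * x + c * x ^+ 2).
have intb (b : R) : N.-integrable setT (EFin \o (fun x : R => b * x)).
  exact: integrableZl int1.
have intc (c : R) : N.-integrable setT (EFin \o (fun x : R => c * x ^+ 2)).
  exact: integrableZl int2.
have intbc (b c : R) : N.-integrable setT (EFin \o (fun x : R => b * x + c * x ^+ 2)).
  exact: (integrableD measurableT (intb b) (intc c)).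
have intq a b c : N.-integrable setT (EFin \o q a b c).
  exact: (integrableD measurableT (int0 a) (intbc b c)).
have Eq a b c : (\int[mu]_x (q a b c x * p x)%:E = (a + (b * e + c * v))%:E)%E.
  transitivity (\int[N]_x (q a b c x)%:E)%E.
    by rewrite (integral_normal_prob (intq a b c)); apply: eq_integral.
  transitivity (\int[N]_x a%:E +
      (\int[N]_x (b%:E * x%:E) + \int[N]_x (c%:E * (x ^+ 2)%:E)))%E.
    transitivity (\int[N]_x a%:E + \int[N]_x (b * x + c * x ^+ 2)%:E)%E.
      exact: (integralD_EFin measurableT (int0 a) (intbc b c)).
    congr (_ + _)%E.
    exact: (integralD_EFin measurableT (intb b) (intc c)).
  rewrite (integralZl measurableT int1) (integralZl measurableT int2) Ee Ev.
  by rewrite integral_cst//= probability_setT mule1.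
have cq a b c : continuous (fun x => q a b c x * p x).
  move=> x; apply: cvgM; last exact: continuous_normal_pdf.
  by rewrite /q; apply: cvgD; [exact: cvg_cst|apply: cvgD;
    [apply: cvgM; [exact: cvg_cst|exact: cvg_id]
    |apply: cvgM; [exact: cvg_cst|exact: exprn_continuous]]].
have peak0 : 0 <= normal_peak s by exact: normal_peak_ge0.
have em : e = m.
  have := @integral_derivative_eq0 R _ (fun x => s ^+ 2 * p x) m
    (s ^+ 2 * (normal_peak s + 2 * s ^+ 2 * normal_peak s))
    (cq m (-1) 0) (integrable_normal_density (intq m (-1) 0)).
  rewrite Eq => h; have {}h : (m + (-1 * e + 0 * v))%:E = 0%E.
    apply: h => x.
      apply: is_derive_eq (is_deriveZ (s ^+ 2) (is_derive_pdf x)) _.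
      by rewrite /GRing.scale/= /q; field.
    rewrite normrM (ger0_norm (sqr_ge0 _)) -[leLHS]mulrA.
    apply: ler_wpM2l; first exact: sqr_ge0.
    by rewrite (ger0_norm (normal_pdf_ge0 _ _ _)).
  by case: h; lra.
split; first by rewrite Ee em.
have := @integral_derivative_eq0 R _ (fun x => (x - m) * (s ^+ 2 * p x)) m
  (s ^+ 2 * (2 * s ^+ 2 * normal_peak s))
  (cq (s ^+ 2 - m ^+ 2) (2 * m) (-1))
  (integrable_normal_density (intq (s ^+ 2 - m ^+ 2) (2 * m) (-1))).
rewrite Eq => h.
have {}h : (s ^+ 2 - m ^+ 2 + (2 * m * e + -1 * v))%:E = 0%E.
  apply: h => x.
    have d1 : is_derive x 1 (fun x : R => x - m) 1.
      by apply: is_derive_eq; rewrite subr0.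
    have := is_deriveM d1 (is_deriveZ (s ^+ 2) (is_derive_pdf x)).
    move=> h; apply: is_derive_eq h _.
    rewrite /GRing.scale/= /q.
    by change (s ^+ 2 *: p x) with (s ^+ 2 * p x); field.
  rewrite normrM mulrAC -expr2 real_normK ?num_real// mulrC normrM.
  rewrite (ger0_norm (sqr_ge0 _)) -[leLHS]mulrA.
  apply: ler_wpM2l; first exact: sqr_ge0.
  by rewrite (ger0_norm (normal_pdf_ge0 _ _ _)).
case: h; rewrite em; lra.
Qed.

End normal_moments.

(** * The one-dimensional laws of white noise *)

Section white_noise_law.
Variables (R : realType) (d : measure_display) (Om : measurableType d).
Variable P : probability Om R.

Lemma integrable_of_sqr (X : {RV P >-> R}) (v : R) :
  ('E_P[fun w => (X w * X w)%R] = v%:E)%E -> P.-integrable setT (EFin \o X).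
Proof.
rewrite unlock => Ev.
have mX : measurable_fun setT (EFin \o X) by exact/measurable_EFinP.
have int2 : P.-integrable setT (EFin \o (fun w => X w * X w)).
  apply/integrableP; split; first exact/measurable_EFinP/measurable_funM.
  under eq_integral do rewrite /= ger0_norm -?expr2 ?sqr_ge0//.
  by rewrite Ev ltry.
have int1 : P.-integrable setT (EFin \o cst (1 : R)).
  exact: finite_measure_integrable_cst.
(* The dominating function is [1 + X ^+ 2]. *)
apply: (le_integrable measurableT mX _ (integrableD measurableT int1 int2)).
move=> w _ /=; rewrite lee_fin ler_norml.
rewrite ger0_norm ?addr_ge0// -?expr2 ?sqr_ge0//; apply/andP; split; nra.
Qed.

(** Joint Gaussianity, used for a single vector, gives a Gaussian law with unknown parameters; the
    prescribed first and second moments then identify them. *)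
Lemma white_noise_prob (Y : hilbertType R) (Z : Y -> {RV P >-> R}) (g : Y)
    (A : set R) : white_noise Z -> g != 0 -> measurable A ->
  P [set w | A (Z g w)] = normal_prob 0 `|g| A.
Proof.
move=> [_ gaussZ EZ EZZ] g0.
have [m [s [s0 lawZ1]]] := gaussZ 1 (fun=> g) (fun=> 1).
have lawZ (B : set R) : measurable B -> P [set w | B (Z g w)] = gaussian m s B.
  move=> mB; rewrite -lawZ1//; congr (P _).
  by apply/seteqP; split => w /=; rewrite big_ord1 mul1r.
have E1 := EZ g; have E2 := EZZ g g.
have intZ := integrable_of_sqr E2.
move: E1 E2; rewrite inner_normE !unlock => E1 E2.
have m1 : measurable_fun [set: measurableTypeR R] (fun x : R => x%:E).
  exact/measurable_EFinP.
have m2 : measurable_fun [set: measurableTypeR R] (fun x : R => (x ^+ 2)%:E).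
  exact/measurable_EFinP/measurable_funX.
(* Moments of [Z g] are moments of its image measure, whichever form the Gaussian law takes. *)
have pushE (nu : probability (measurableTypeR R) R) :
    (forall B, measurable B -> P [set w | B (Z g w)] = nu B) ->
    (\int[nu]_x x%:E = 0 /\ \int[nu]_x (x ^+ 2)%:E = (`|g| ^+ 2)%:E)%E.
  move=> nuE.
  have mZ : measurable_fun setT (Z g : Om -> measurableTypeR R).
    by move=> mT B mB; exact: (@measurable_funPT _ _ _ _ (Z g) mT B mB).
  have sq_ge0 : {in [set: measurableTypeR R], forall x : R, (0%R <= (x ^+ 2)%:E)%E}.
    by move=> x _; rewrite lee_fin sqr_ge0.
  split.
    rewrite -E1 -(integral_pushforward mZ m1 intZ measurableT).
    by apply: eq_measure_integral => B mB _; exact: esym (nuE B mB).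
  rewrite -E2 -(ge0_integral_pushforward mZ P measurableT m2 sq_ge0).
  by apply: eq_measure_integral => B mB _; exact: esym (nuE B mB).
move: s0; rewrite le_eqVlt => /predU1P[s0|s_gt0] mA.
  (* The degenerate case is impossible: mean zero puts the point mass at 0, against a second moment
     equal to the nonzero squared norm of [g]. *)
  have [|] := pushE (@dirac _ (measurableTypeR R) m R).
    by move=> B mB; rewrite lawZ// /gaussian -s0 eqxx.
  rewrite (integral_dirac _ measurableT m1) (integral_dirac _ measurableT m2).
  rewrite diracT !mul1e => -[->] [] /esym/eqP.
  by rewrite expr0n/= sqrf_eq0 normr_eq0 (negbTE g0).
have [|N1 N2] := pushE (normal_prob m s).
  by move=> B mB; rewrite lawZ// /gaussian gt_eqF.
have [N1' v] := normal_prob_moments s_gt0 N2.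
move: N1; rewrite N1' => -[m0]; rewrite m0 in v *.
rewrite lawZ// /gaussian gt_eqF// m0; congr (normal_prob 0 _ A).
by apply/eqP; rewrite -(eqrXn2 (n := 2))// ?ltW// v expr0n/= addr0.
Qed.

End white_noise_law.

(** * The MAP test as a threshold test *)

Section map_test.
Variables (R : realType) (X Y : hilbertType R) (T : {linear X -> Y}).
Variables (sigma : R) (S : {linear X -> X}) (phi m0 : X).
Hypotheses (bT : bounded_map T) (bS : bounded_map S) (S_sa : self_adjoint S).
Hypothesis sigma_gt0 : 0 < sigma.

Local Notation Phi := (Phi_MAP T sigma S phi).

(** Self-adjointness moves [S] and the resolvent onto [phi]; the Riesz property of [pullback] then
    evaluates the recentered data at [T (S (resolvent T sigma S (S phi)))], which is [Phi]. *)
Lemma inner_posterior_mean (y : Y -> R) : scalar y ->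
  bounded_map (fun x : X => y (T (S x)) : R^o) ->
  inner phi (posterior_mean T sigma S m0 y) =
  inner phi m0 + (y Phi - inner (T m0) Phi).
Proof.
move=> ly by_; rewrite /posterior_mean innerDr -S_sa.
rewrite (inner_resolvent bT bS S_sa sigma_gt0) [inner (resolvent _ _ _ _) _]innerC.
rewrite /pullback rieszE//.
  by move=> a u v; rewrite !linearP ly innerDr innerZr; ring.
have lyTS : scalar (fun x => y (T (S x))) by move=> a u v; rewrite !linearP ly.
have [M M0 yM] := @bounded_mapP R X R^o _ lyTS by_.
have [K K0 TK] := bounded_mapP (linearP T) bT.
have [L L0 SL] := bounded_mapP (linearP S) bS.
(* [M] bounds the data part; the other term bounds the recentering by [T m0], through Cauchy-Schwarz
   and the bounds [K] of [T] and [L] of [S]. *)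
apply: (@bound_bounded_map R X R^o _ (M + `|T m0| * (K * L))) => x.
rewrite (le_trans (ler_normB _ _))// mulrDl lerD//.
apply: le_trans (cauchy_schwarz _ _) _; rewrite -mulrA ler_wpM2l//.
by apply: le_trans (TK _) _; rewrite -mulrA ler_pM2l.
Qed.

(** The variance is [sigma ^+ 2] times the resolvent form at [S phi], and [S phi = 0] would make
    [Phi] vanish. *)
Lemma posterior_variance_gt0 : Phi != 0 ->
  0 < inner phi (posterior_cov T sigma S phi).
Proof.
move=> Phi0; rewrite /posterior_cov innerZr -S_sa mulr_gt0 ?exprn_gt0//.
apply: inner_resolvent_gt0 => //; apply: contra_neq Phi0 => Sphi0.
rewrite /Phi_MAP; suff -> : resolvent T sigma S (S phi) = 0 by rewrite !linear0.
apply/eqP; rewrite -normr_eq0 -sqrf_eq0 -inner_normE.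
by rewrite (inner_resolvent bT bS S_sa sigma_gt0) Sphi0 innerC inner0l.
Qed.

Lemma Psi_MAP_eq1 (post : (Y -> R) -> probability (borel X) R) (y : Y -> R) :
  is_posterior T sigma S m0 post -> Phi != 0 -> scalar y ->
  bounded_map (fun x : X => y (T (S x)) : R^o) ->
  (Psi_MAP post phi y = 1%N) <-> inner m0 (adjoint T Phi - phi) < y Phi.
Proof.
move=> postP Phi0 ly by_.
have var0 := posterior_variance_gt0 Phi0.
have gaussE (B : set R) : measurable B ->
    post y [set x | B (inner phi x)] =
    normal_prob (inner phi m0 + (y Phi - inner (T m0) Phi))
      (Num.sqrt (inner phi (posterior_cov T sigma S phi))) B.
  move=> mB; rewrite (postP y ly by_ phi B mB) /gaussian.
  by rewrite gt_eqF ?sqrtr_gt0// inner_posterior_mean.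
(* Both hypotheses are preimages of half-lines under [inner phi], so only the marginal of the
   posterior along [phi] matters. *)
have HE : X_H phi = [set x | `]-oo, 0%R]%classic (inner phi x)].
  by apply/seteqP; split => x; rewrite /X_H /= in_itv.
have KE : X_K phi = [set x | `]0%R, +oo[%classic (inner phi x)].
  by apply/seteqP; split => x; rewrite /X_K /= in_itv/= andbT.
rewrite /Psi_MAP HE KE !gaussE// normal_prob_sign ?sqrtr_gt0//.
rewrite innerDr innerNr (innerC m0 (adjoint _ _)) adjointE// (innerC m0 phi).
rewrite (_ : 0 < _ = (inner (T m0) Phi - inner phi m0 < y Phi)); last first.
  by apply/idP/idP; lra.
by case: ifP.
Qed.

End map_test.

(** * Level and power of the MAP test *)

Theorem corollary2p13 (R : realType) (X Y : hilbertType R)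
  (sepX : separable_space X) (sepY : separable_space Y)
  (phi : X) (T : {linear X -> Y}) (bT : bounded_map T)
  (sigma : R) (sigma_gt0 : 0 < sigma) (m0 : X)
  (C0 : {linear X -> X}) (C0sa : self_adjoint C0)
  (C0pd : positive_definite C0) (C0tr : trace_class C0)
  (C0half : {linear X -> X}) (SC0 : is_sqrt C0 C0half)
  (d : measure_display) (Om : measurableType d) (P : probability Om R)
  (Z : Y -> {RV P >-> R}) (whiteZ : white_noise Z)
  (data_bounded : forall u : X,
     {ae P, forall w, bounded_map
        (fun x : X => data T sigma Z u w (T (C0half x)) : R^o)})
  (post : (Y -> R) -> probability (borel X) R)
  (postP : is_posterior T sigma C0half m0 post)
  (alpha : R) (alpha01 : 0 < alpha < 1)
  (* the Banach spaces V and V', inside a common vector space W with X *)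
  (W : lmodType R) (V V' : completeNormedModType R)
  (jX : {linear X -> W}) (jV : {linear V -> W}) (jV' : {linear V' -> W})
  (jX_inj : injective jX) (jV_inj : injective jV) (jV'_inj : injective jV')
  (duality : forall (u v : X) (u' : V') (v' : V),
     jV' u' = jX u -> jV v' = jX v -> inner u v <= `|u'| * `|v'|)
  (TsV : Y -> V') (TsVE : forall g, jV' (TsV g) = jX (adjoint T g))
  (bTsV : bounded_map TsV)
  (phiV : V') (phiVE : jV' phiV = jX phi)
  (phi_closure : closure (range TsV) phiV)
  (Phi_neq0 : Phi_MAP T sigma C0half phi != 0)
  (m0E : let Phi := Phi_MAP T sigma C0half phi in
     inner m0 (adjoint T Phi - phi) =
       sigma * `|Phi| * Qinv (1 - alpha) + `|TsV Phi - phiV|) :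
  (forall u : X, X_H phi u -> (exists2 v : V, jV v = jX u & `|v| <= 1) ->
     exists2 p, has_prob P
       [set w | Psi_MAP post phi (data T sigma Z u w) = 1%N] p
       & (p <= alpha%:E)%E) /\
  (forall u : X, X_K phi u -> (exists2 v : V, jV v = jX u & `|v| <= 1) ->
     has_prob P [set w | Psi_MAP post phi (data T sigma Z u w) = 1%N]
       (Q (Qinv alpha - J TsV phiV (T u) (Phi_MAP T sigma C0half phi) / sigma))%:E).
Proof.
have [bS S_sa _ _] := SC0.
set Phi := Phi_MAP T sigma C0half phi in Phi_neq0 m0E *.
move: m0E; cbv zeta => m0E.
set nrm := `|TsV Phi - phiV| in m0E.
have [lZ _ _ _] := whiteZ.
have nPhi : 0 < `|Phi| by rewrite normr_gt0.
(* The threshold event is measurable and serves as the witness in [has_prob] for the rejection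
   event. *)
pose A u : set Om := [set w | inner m0 (adjoint T Phi - phi) < data T sigma Z u w Phi].
have AE u : A u = [set w |
    `](inner m0 (adjoint T Phi - phi) - inner (T u) Phi) / sigma, +oo[%classic
      (Z Phi w)].
  apply/seteqP; split => w; rewrite /A /data /= in_itv/= andbT;
    by rewrite ltr_pdivrMr// ltrBlDl [Z Phi w * _]mulrC.
have probA u : P (A u) =
    (Q (Qinv alpha - J TsV phiV (T u) Phi / sigma))%:E.
  rewrite AE (white_noise_prob whiteZ Phi_neq0)//.
  (* The choice of [m0] turns the standardized threshold into [Qinv (1 - alpha)] plus [J / sigma];
     the symmetry of [Q] changes both signs. *)
  rewrite normal_prob_compl_ray// -QN m0E Qinv_onem//; congr (Q _)%:E.
  rewrite /J -/nrm (innerC (T u)); field.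
  by rewrite !gt_eqF.
have mA u : measurable (A u).
  rewrite AE -[X in measurable X]setTI.
  exact: (@measurable_funPT _ _ _ _ (Z Phi)).
have has_prob_test u : has_prob P
    [set w | Psi_MAP post phi (data T sigma Z u w) = 1%N]
    (Q (Qinv alpha - J TsV phiV (T u) Phi / sigma))%:E.
  exists (A u); split => //.
  (* The two events can differ only where the pulled back data functional is unbounded, which is a
     null set. *)
  apply: negligibleS (data_bounded u) => w wAE bw.
  have lw : scalar (data T sigma Z u w).
    by move=> a x y; rewrite /data innerDr innerZr (lZ w); ring.
  have := Psi_MAP_eq1 bT bS S_sa sigma_gt0 postP Phi_neq0 lw bw.
  by move=> [PsiA APsi]; case: wAE => -[] => [/APsi|/PsiA].
split=> [u Hu [v vu v1]|u _ _]; last exact: has_prob_test.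
exists (Q (Qinv alpha - J TsV phiV (T u) Phi / sigma))%:E; first exact: has_prob_test.
(* Since [alpha = Q (Qinv alpha)], the level bound reduces by monotonicity to the nonnegativity of
   [J]. *)
rewrite lee_fin -[leRHS]QinvK//; apply: Q_le.
rewrite lerBlDr lerDl; apply: divr_ge0; last exact: ltW.
rewrite /J; apply: divr_ge0; last exact: ltW.
rewrite subr_ge0 -/nrm.
(* Duality is applied to [TsV Phi - phiV] and [v], which represent these two vectors in [V'] and
   [V]. As [inner phi u <= 0] and the norm of [v] is at most 1, [inner Phi (T u)] is at most
   [nrm]. *)
have : inner (adjoint T Phi - phi) u <= nrm * `|v|.
  by apply: duality vu; rewrite !linearB TsVE phiVE.
rewrite innerDl innerNl adjointE// (innerC (T u)).
move: Hu; rewrite /X_H /= => Hu.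
have : nrm * `|v| <= nrm by rewrite ler_piMr// normr_ge0.
lra.
Qed.
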